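(* Let $\mathcal X$ be a zero-nonzero pattern and let $\mathcal X'$ be obtained by appending a column to $\mathcal X$ whose zero set is the intersection of the zero sets of some subset of the columns of $\mathcal X$. Then $\operatorname{mr}\mathcal R(\mathcal X')=\operatorname{mr}\mathcal R(\mathcal X)$.
   Context: A zero-nonzero pattern is a matrix with entries in $\{0,*\}$. The zero set of a row is the set of column labels where it has entry $0$; the zero set of a column is the set of row labels where it has entry $0$. For a pattern $\mathcal X$, $\mathcal R(\mathcal X)$ is the set of matroids on the set of column labels of $\mathcal X$ such that the zero set of every row of $\mathcal X$ is a flat, and $\operatorname{mr}\mathcal R(\mathcal X)$ is the smallest rank of a matroid in $\mathcal R(\mathcal X)$. *)

(* Defs.v *)
From HB Require Import structures.
From mathcomp Require Import all_boot all_order all_algebra.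

Set Implicit Arguments.
Unset Strict Implicit.
Unset Printing Implicit Defensive.

(* I is the collection of independent sets of a matroid on the ground set E. *)
Definition is_matroid (E : finType) (I : {set {set E}}) : bool :=
  [&& set0 \in I,
      [forall A : {set E}, forall B : {set E},
         (B \in I) && (A \subset B) ==> (A \in I)]
    & [forall A : {set E}, forall B : {set E},
         [&& A \in I, B \in I & #|A| < #|B|] ==>
           [exists x in B :\: A, x |: A \in I]]].

Record matroid (E : finType) :=
  Matroid { indep : {set {set E}}; indepP : is_matroid indep }.

HB.instance Definition _ (E : finType) := [isSub for @indep E].
HB.instance Definition _ (E : finType) := [Finite of matroid E by <:].

Definition rk (E : finType) (M : matroid E) (A : {set E}) : nat :=
  \max_(B in indep M | B \subset A) #|B|.

Definition rank (E : finType) (M : matroid E) : nat := rk M [set: E].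

Definition closure (E : finType) (M : matroid E) (A : {set E}) : {set E} :=
  [set x | rk M (x |: A) == rk M A].

Definition flat (E : finType) (M : matroid E) (F : {set E}) : bool :=
  closure M F == F.

(* The entries of a zero-nonzero pattern are encoded by booleans:             *)
(* false stands for 0 and true stands for *.                                  *)
Notation pattern m n := 'M[bool]_(m, n).

Definition row_zero_set (m n : nat) (X : pattern m n) (i : 'I_m) : {set 'I_n} :=
  [set j | X i j == false].

Definition col_zero_set (m n : nat) (X : pattern m n) (j : 'I_n) : {set 'I_m} :=
  [set i | X i j == false].

Definition patternR (m n : nat) (X : pattern m n) : {set matroid 'I_n} :=
  [set M | [forall i, flat M (row_zero_set X i)]].

Lemma free_is_matroid (E : finType) : is_matroid [set: {set E}].
Proof.
apply/and3P; split; first by rewrite inE.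
  by apply/forallP => A; apply/forallP => B; rewrite !inE implybT.
apply/forallP => A; apply/forallP => B; apply/implyP; rewrite !inE /= => ltAB.
have : ~~ (B \subset A) by apply/negP => /subset_leq_card; rewrite leqNgt ltAB.
case/subsetPn => x xB xA; apply/existsP; exists x.
by rewrite !inE xB xA.
Qed.

Definition free_matroid (E : finType) : matroid E :=
  Matroid (free_is_matroid E).

Lemma rk_free (E : finType) (A : {set E}) : rk (free_matroid E) A = #|A|.
Proof.
apply/eqP; rewrite eqn_leq; apply/andP; split.
  by apply/bigmax_leqP => B /andP[_ /subset_leq_card].
by apply: (@leq_bigmax_cond _ _ (fun B : {set E} => #|B|) A); rewrite inE /=.
Qed.

Lemma free_in_patternR (m n : nat) (X : pattern m n) :
  free_matroid 'I_n \in patternR X.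
Proof.
rewrite inE; apply/forallP => i; apply/eqP/setP => x.
rewrite /closure inE !rk_free cardsU1.
by case: (x \in row_zero_set X i); rewrite /= ?eqxx // add1n eqn_leq ltnn.
Qed.

Lemma patternR_rank_ex (m n : nat) (X : pattern m n) :
  exists r, [exists M in patternR X, rank M == r].
Proof.
exists (rank (free_matroid 'I_n)); apply/existsP; exists (free_matroid 'I_n).
by rewrite free_in_patternR eqxx.
Qed.

(* Well defined since the free matroid always belongs to patternR X. *)
Definition mrR (m n : nat) (X : pattern m n) : nat :=
  ex_minn (patternR_rank_ex X).

(* Main.v *)
(** Given [M] in R(X), take the principal extension of [M] by a new element [e]
    placed freely on the flat spanned by [S]: [A + e] is independent iff
    [A + s] is, for some [s] in [S] outside [A].  Its rank is that of [M], and
    the closure of a flat [F] of [M] contains [e] exactly when [S] is contained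
    in [F], which is the condition for the new column to vanish on the
    corresponding row.  Conversely, deleting the new element from a matroid in
    R(X') gives a matroid in R(X) of no larger rank. *)

Require Import Defs.
From HB Require Import structures.
From mathcomp Require Import all_boot all_order all_algebra.

Set Implicit Arguments.
Unset Strict Implicit.
Unset Printing Implicit Defensive.

(** * Independence, bases and flats *)

Section MatroidTheory.

Variables (E : finType) (M : matroid E).
Implicit Types A B F : {set E}.

Lemma indep0 : set0 \in indep M.
Proof. by case/and3P: (indepP M). Qed.

Lemma indepS A B : A \subset B -> B \in indep M -> A \in indep M.
Proof.
case/and3P: (indepP M) => _ /forallP/(_ A)/forallP/(_ B)/implyP h _ sAB IB.
by apply: h; rewrite IB.
Qed.

Lemma indep_augment A B : A \in indep M -> B \in indep M -> #|A| < #|B| ->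
  exists x, [/\ x \in B, x \notin A & x |: A \in indep M].
Proof.
case/and3P: (indepP M) => _ _ /forallP/(_ A)/forallP/(_ B)/implyP h IA IB lAB.
have /existsP[x] : [exists x in B :\: A, x |: A \in indep M].
  by apply: h; rewrite IA IB.
by rewrite inE => /andP[/andP[xA xB] Ix]; exists x.
Qed.

Lemma card_indep_le_rk A B : B \in indep M -> B \subset A -> #|B| <= rk M A.
Proof.
move=> IB sBA; apply: (@leq_bigmax_cond _ _ (fun C : {set E} => #|C|) B).
by rewrite IB.
Qed.

Lemma ex_basis A : exists B, [/\ B \in indep M, B \subset A & #|B| = rk M A].
Proof.
have := @eq_bigmax_cond _ (fun B => (B \in indep M) && (B \subset A))
  (fun B : {set E} => #|B|).
case=> [|B /andP[IB sBA] eqB]; last by exists B.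
by apply/card_gt0P; exists set0; rewrite unfold_in indep0 sub0set.
Qed.

(** This rank-free form of flatness lets flats be transported between ground sets by moving
    independent sets alone. *)
Lemma flatP F :
  reflect (forall x B, x \notin F -> B \in indep M -> B \subset F ->
             x |: B \in indep M)
          (flat M F).
Proof.
apply: (iffP eqP) => [flF x B xF IB sBF | h].
  have rkx : rk M F < rk M (x |: F).
    have: x \notin Defs.closure M F by rewrite flF.
    rewrite inE ltn_neqAle eq_sym => -> /=.
    have [C [IC sCF <-]] := ex_basis F.
    by apply: card_indep_le_rk => //; apply: subset_trans (subsetUr _ _).
  have [C [IC sCF eqC]] := ex_basis (x |: F).
  (* Enlarge [B] to a maximal independent [D] inside [F]. A basis [C] of [x |: F] is larger, so it
     augments [D]; by maximality the added element is [x]. *)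
  pose P D := [&& D \in indep M, B \subset D & D \subset F].
  have PB : P B by rewrite /P IB subxx.
  case: (@arg_maxnP _ B P (fun D : {set E} => #|D|) PB) => D.
  case/and3P=> ID sBD sDF maxD.
  have ltDC : #|D| < #|C|.
    by rewrite eqC; apply: leq_ltn_trans rkx; apply: card_indep_le_rk.
  have [y [yC yD IyD]] := indep_augment ID IC ltDC.
  have := subsetP sCF y yC; rewrite !inE => /orP[/eqP <- | yF].
    by apply: indepS IyD; apply: setUS.
  have /maxD : P (y |: D).
    rewrite /P IyD subUset sub1set yF sDF !andbT.
    exact: subset_trans sBD (subsetUr _ _).
  by rewrite /= cardsU1 yD add1n ltnn.
apply/setP => x; rewrite inE; have [xF | xF] := boolP (x \in F).
  by rewrite (setUidPr _) ?sub1set ?eqxx.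
apply/negbTE; rewrite neq_ltn; apply/orP; right.
have [B [IB sBF <-]] := ex_basis F.
have xB : x \notin B by apply: contra xF; apply: (subsetP sBF).
have := card_indep_le_rk (h x B xF IB sBF) (setUS [set x] sBF).
by rewrite cardsU1 xB add1n.
Qed.

End MatroidTheory.

(** * Restriction along an injection, which deletes the points outside its image *)

Section Restriction.

Variables (E E' : finType) (f : E -> E') (M : matroid E').
Hypothesis f_inj : injective f.

Lemma restriction_is_matroid :
  is_matroid [set A : {set E} | f @: A \in indep M].
Proof.
apply/and3P; split; first by rewrite inE imset0 indep0.
  apply/forallP=> A; apply/forallP=> B; apply/implyP; rewrite !inE.
  by case/andP=> IB sAB; apply: indepS IB; apply: imsetS.
apply/forallP=> A; apply/forallP=> B; apply/implyP; rewrite !inE.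
case/and3P=> IA IB ltAB; have [|x [xB xA Ix]] := indep_augment IA IB.
  by rewrite !card_imset.
case/imsetP: xB xA Ix => y yB ->; rewrite mem_imset // => yA Iy.
by apply/existsP; exists y; rewrite !inE yA yB imsetU1.
Qed.

Definition restriction : matroid E := Matroid restriction_is_matroid.

Lemma restriction_flat F : flat M F -> flat restriction (f @^-1: F).
Proof.
move/flatP=> flF; apply/flatP=> x B; rewrite !inE imsetU1 => xF IB sBF.
by apply: flF => //; rewrite -sub_imset_pre in sBF.
Qed.

Lemma restriction_rank : rank restriction <= rank M.
Proof.
rewrite {1}/rank.
have [B [IB _ <-]] := ex_basis restriction setT.
rewrite inE in IB; rewrite -(card_imset _ f_inj).
exact: card_indep_le_rk.
Qed.

End Restriction.

(** * Principal extension, with [E'] presented as the image of [f] together with one new point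
    [e] *)

Section PrincipalExtension.

Variables (E E' : finType) (f : E -> E') (e : E').
Hypothesis f_inj : injective f.
Hypothesis f_neq : forall y, f y != e.
Hypothesis f_onto : forall x, x != e -> exists y, x = f y.
Variables (M : matroid E) (S : {set E}).

Definition principal_indep : {set {set E'}} :=
  [set B : {set E'} | (f @^-1: B \in indep M) &&
     ((e \in B) ==>
        [exists s in S :\: f @^-1: B, s |: f @^-1: B \in indep M])].

Lemma principal_indepP (B : {set E'}) :
  reflect (f @^-1: B \in indep M /\
           (e \in B -> exists s, [/\ s \in S, s \notin f @^-1: B &
                                     s |: f @^-1: B \in indep M]))
          (B \in principal_indep).
Proof.
rewrite inE; apply: (iffP andP) => -[IB h]; split=> //.
  move=> eB; case/existsP: (implyP h eB) => s /andP[].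
  by rewrite in_setD => /andP[sB sS] Is; exists s.
apply/implyP => /h[s [sS sB Is]]; apply/existsP; exists s.
by rewrite in_setD sB sS Is.
Qed.

Lemma preimset_setU1_fun y (B : {set E'}) :
  f @^-1: (f y |: B) = y |: f @^-1: B.
Proof. by apply/setP=> z; rewrite !inE (inj_eq f_inj). Qed.

Lemma preimset_setU1_new (B : {set E'}) : f @^-1: (e |: B) = f @^-1: B.
Proof. by apply/setP=> z; rewrite !inE (negbTE (f_neq z)). Qed.

Lemma card_preimset_new (B : {set E'}) : #|B| = (e \in B) + #|f @^-1: B|.
Proof.
rewrite (cardsD1 e); congr addn; rewrite -(card_imset _ f_inj).
apply: eq_card => x; rewrite !inE; apply/andP/imsetP.
  by case=> /f_onto[y ->] yB; exists y; rewrite ?inE.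
by case=> y; rewrite inE => yB ->; rewrite f_neq.
Qed.

Lemma principal_augment_fun y (B : {set E'}) :
  y |: f @^-1: B \in indep M ->
  (e \in B -> exists s, [/\ s \in S, s \notin y |: f @^-1: B &
                            s |: (y |: f @^-1: B) \in indep M]) ->
  f y |: B \in principal_indep.
Proof.
move=> Iy h; apply/principal_indepP; rewrite preimset_setU1_fun; split=> //.
by rewrite in_setU1 eq_sym (negbTE (f_neq y)).
Qed.

Lemma principal_augment_new s (B : {set E'}) :
  f @^-1: B \in indep M -> s \in S -> s \notin f @^-1: B ->
  s |: f @^-1: B \in indep M -> e |: B \in principal_indep.
Proof.
move=> IB sS sB Is; apply/principal_indepP; rewrite preimset_setU1_new.
by split=> // _; exists s.
Qed.

(** Exchange is carried out in [M] on the traces [a] and [b]. When [e] lies in [A], the added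
    element must also leave some element of [S] able to stand in for [e]; this decides the case
    split. *)
Lemma principal_exchange (A B : {set E'}) :
  A \in principal_indep -> B \in principal_indep -> #|A| < #|B| ->
  exists x, [/\ x \in B, x \notin A & x |: A \in principal_indep].
Proof.
move=> /principal_indepP[IA hA] /principal_indepP[IB hB].
rewrite !card_preimset_new; set a := f @^-1: A in IA hA *.
set b := f @^-1: B in IB hB *.
have use_fun y : y \in b -> y \notin a -> y |: a \in indep M ->
    (e \in A -> exists s, [/\ s \in S, s \notin y |: a &
                              s |: (y |: a) \in indep M]) ->
    exists x, [/\ x \in B, x \notin A & x |: A \in principal_indep].
  move=> yb ya Iy h; exists (f y); rewrite !inE in yb ya.
  by rewrite yb ya; split=> //; apply: principal_augment_fun.
(* An element of [b] that augments [s |: a], not just [a], keeps [s] as the stand-in for [e]. *)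
have use_witness s y : s \in S -> s \notin a -> y \in b -> y \notin s |: a ->
    y |: (s |: a) \in indep M ->
    exists x, [/\ x \in B, x \notin A & x |: A \in principal_indep].
  move=> sS sa yb; rewrite in_setU1 negb_or => /andP[ys ya] Iys.
  apply: (use_fun y) => //.
    by apply: indepS Iys; apply/setUS/subsetUr.
  move=> _; exists s; split=> //; first by rewrite in_setU1 negb_or eq_sym ys.
  by rewrite setUCA.
have [eA | eA] := boolP (e \in A); last first.
  have [eB | eB] := boolP (e \in B); rewrite ?add0n ?add1n => lt_ab.
    (* Here [a] and [b] may have equal size, so augment from [t |: b]. If [t] itself is drawn, [e]
       is the element to add. *)
    have [t [tS tb It]] := hB eB.
    have [|x [xt xa Ix]] := indep_augment IA It; first by rewrite cardsU1 tb.
    case/setU1P: xt => [xeq | xb].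
      exists e; split=> //; rewrite xeq in xa Ix.
      exact: (principal_augment_new IA tS).
    by apply: (use_fun x) => //; rewrite (negbTE eA).
  have [x [xb xa Ix]] := indep_augment IA IB lt_ab.
  by apply: (use_fun x) => //; rewrite (negbTE eA).
have [s [sS sa Is]] := hA eA; rewrite add1n.
have [lt_sab _ | le_ba] := ltnP #|a|.+1 #|b|.
  have [|x [xb xsa Ix]] := indep_augment Is IB; first by rewrite cardsU1 sa.
  exact: (use_witness s x).
(* Now [b] is too small to augment [s |: a] by size alone. The strict inequality forces [e] into
   [B], whose stand-in [t] supplies the missing element. *)
have [eB | eB] := boolP (e \in B); last by rewrite add0n ltnNge le_ba.
rewrite add1n ltnS => lt_ab; have [t [tS tb It]] := hB eB.
have [|x [xt xsa Ix]] := indep_augment Is It.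
  by rewrite !cardsU1 sa tb ltnS.
case/setU1P: xt => [xeq | xb]; last exact: (use_witness s x).
rewrite {x}xeq in xsa Ix.
(* Now [a + s + t] is independent, so any augmentation of [a] by an element of
   [b] can be augmented further by [s] or [t], both of which lie in [S]. *)
have [y [yb ya Iy]] := indep_augment IA IB lt_ab.
apply: (use_fun y) => // _.
have [|u [ust uya Iu]] := indep_augment Iy Ix.
  by rewrite !cardsU1 xsa sa ya.
exists u; split=> //.
move: ust uya; rewrite !inE => /or3P[/eqP -> // | /eqP -> // | uA].
by rewrite uA orbT.
Qed.

Lemma principal_is_matroid : is_matroid principal_indep.
Proof.
apply/and3P; split.
- apply/principal_indepP; rewrite preimset0 inE; split=> //; exact: indep0.
- apply/forallP=> A; apply/forallP=> B; apply/implyP.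
  case/andP=> /principal_indepP[IB hB] sAB; have sab := preimsetS f sAB.
  apply/principal_indepP; split; first exact: indepS IB.
  move=> eA; have [s [sS sB Is]] := hB (subsetP sAB e eA).
  exists s; split=> //; first by apply: contra sB; apply: (subsetP sab).
  by apply: indepS Is; apply: setUS.
- apply/forallP=> A; apply/forallP=> B; apply/implyP; case/and3P=> IA IB ltAB.
  have [x [xB xA Ix]] := principal_exchange IA IB ltAB.
  by apply/existsP; exists x; rewrite in_setD xA xB.
Qed.

Definition principal_extension : matroid E' := Matroid principal_is_matroid.

(** Replacing [e] by its stand-in [s] turns a basis into an independent set of [M] of the same
    size. *)
Lemma principal_rank : rank principal_extension <= rank M.
Proof.
rewrite {1}/rank.
have [B [/principal_indepP[IB hB] _ <-]] := ex_basis principal_extension setT.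
rewrite card_preimset_new; case: (e \in B) hB => [/(_ isT)[s [_ sB Is]] | _].
  by have := card_indep_le_rk Is (subsetT _); rewrite cardsU1 sB.
exact: card_indep_le_rk (subsetT _).
Qed.

Lemma principal_flat (F : {set E'}) :
  flat M (f @^-1: F) -> (e \in F) = (S \subset f @^-1: F) ->
  flat principal_extension F.
Proof.
move=> /flatP flF eF; apply/flatP=> x B xF /principal_indepP[IB hB] sBF.
have sbF := preimsetS f sBF.
(* If [x] is [e], some [s] of [S] lies outside the flat and serves as stand-in. Otherwise [x] is
   [f y]; if [e] is in [B], then [S] lies in the flat, so the old stand-in differs from [y] and
   survives adding [y]. *)
have [xe | /f_onto[y xy]] := eqVneq x e.
  move: xF; rewrite xe eF => /subsetPn[s sS sF].
  apply: (principal_augment_new IB sS); last exact: flF.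
  by apply: contra sF; apply: (subsetP sbF).
have yF : y \notin f @^-1: F by rewrite inE -xy.
rewrite xy; apply: principal_augment_fun; first exact: flF.
move=> eB; have [s [sS sB Is]] := hB eB.
have sF : s \in f @^-1: F.
  by apply: (subsetP _ s sS); rewrite -eF; apply: (subsetP sBF).
exists s; split=> //.
  by rewrite in_setU1 negb_or sB andbT; apply: contra yF => /eqP <-.
by rewrite setUCA; apply: flF => //; rewrite subUset sub1set sF.
Qed.

End PrincipalExtension.

(** * Minimum rank and the appended column *)

Lemma mrR_le (m n : nat) (X : pattern m n) (M : matroid 'I_n) :
  M \in patternR X -> mrR X <= rank M.
Proof.
rewrite /mrR => MX; case: ex_minnP => r _; apply.
by apply/existsP; exists M; rewrite MX eqxx.
Qed.

Lemma mrR_attained (m n : nat) (X : pattern m n) :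
  exists2 M : matroid 'I_n, M \in patternR X & rank M = mrR X.
Proof.
rewrite /mrR; case: ex_minnP => r /existsP[M /andP[MX /eqP rM]] _.
by exists M.
Qed.

Lemma row_zero_set_lshift (m n p : nat) (X : pattern m n) (Y : pattern m p) i :
  lshift p @^-1: row_zero_set (row_mx X Y) i = row_zero_set X i.
Proof. by apply/setP=> j; rewrite !inE row_mxEl. Qed.

Theorem theorem4p8 (m n : nat) (X : pattern m n) (c : pattern m 1)
    (S : {set 'I_n})
    (hc : col_zero_set c ord0 = \bigcap_(j in S) col_zero_set X j) :
  mrR (row_mx X c) = mrR X.
Proof.
apply/eqP; rewrite eqn_leq; apply/andP; split.
  have [M MX <-] := mrR_attained X.
  have f_neq (y : 'I_n) : lshift 1 y != rshift n ord0 by rewrite eq_lrshift.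
  have f_onto (x : 'I_(n + 1)) :
      x != rshift n ord0 -> exists y, x = lshift 1 y.
    by case: (split_ordP x) => j ->; [exists j | rewrite ord1 eqxx].
  apply: leq_trans (principal_rank (@lshift_inj n 1) f_neq f_onto M S).
  apply: mrR_le; rewrite inE; apply/forallP=> i.
  apply: principal_flat; rewrite row_zero_set_lshift.
    by move: MX; rewrite inE => /forallP.
  rewrite inE row_mxEr.
  (* Read at row [i], [hc] says that the new entry is zero exactly when row [i] vanishes on all of
     [S]. *)
  have := congr1 (fun Z : {set 'I_m} => i \in Z) hc; rewrite inE => ->.
  by apply/bigcapP/subsetP => h j /h; rewrite !inE.
have [M MX <-] := mrR_attained (row_mx X c).
apply: leq_trans (restriction_rank M (@lshift_inj n 1)).
apply: mrR_le; rewrite inE; apply/forallP=> i.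
rewrite -(row_zero_set_lshift X c i); apply: restriction_flat.
by move: MX; rewrite inE => /forallP.
Qed.
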